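(* Let $\gamma\colon\mathbb{C}\to\mathbb{C}^m$ be a polynomial generic injection and let $f\colon\Gamma\to\mathbb{C}$ be a non-constant c-holomorphic function with algebraic graph on the algebraic curve $\Gamma:=\gamma(\mathbb{C})$. Then $$\mathcal{L}_\infty(f)=\mathcal{B}(f)=\frac{\mathrm{d}(f)}{\deg\Gamma}=\frac{\deg(f\circ\gamma)}{\deg\gamma}.$$
   Context: A polynomial generic injection $\gamma\colon\mathbb{C}\to\mathbb{C}^m$ is a (non-constant) polynomial mapping for which there is a finite set $Z\subset\gamma(\mathbb{C})$ such that $\gamma|_{\mathbb{C}\setminus\gamma^{-1}(Z)}\colon\mathbb{C}\setminus\gamma^{-1}(Z)\to\gamma(\mathbb{C})\setminus Z$ is injective. Then $\gamma(\mathbb{C})$ is an irreducible algebraic curve. For $\gamma=(\gamma_1,\dots,\gamma_m)$, $\deg\gamma:=\max_j\deg\gamma_j$. The composition $f\circ\gamma\colon\mathbb{C}\to\mathbb{C}$ is a polynomial, and $\deg(f\circ\gamma)$ is its degree. A function $f\colon\Gamma\to\mathbb{C}$ on an analytic set $\Gamma$ is c-holomorphic if it is continuous on $\Gamma$ and holomorphic on the set of regular points of $\Gamma$. For a c-holomorphic function $f\colon\Gamma\to\mathbb{C}$ with algebraic graph: - the growth exponent is $\mathcal{B}(f):=\inf\{s\geq 0\mid \exists C>0\ \forall x\in\Gamma:\ |f(x)|\leq C(1+|x|)^s\}$; - the Łojasiewicz exponent at infinity is $\mathcal{L}_\infty(f):=\sup\{\ell>0\mid \exists C,R>0\ \forall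 x\in\Gamma,\ |x|\geq R:\ |f(x)|\geq C|x|^\ell\}$; - $\mathrm{d}(f)$ is the geometric degree, i.e. the cardinality of $f^{-1}(w)$ for generic $w\in\mathbb{C}$ (all $w$ outside a finite set). $\deg\Gamma$ is the projective degree of the curve $\Gamma\subset\mathbb{C}^m$: the maximal number of points of $H\cap\Gamma$ over affine hyperplanes $H\subset\mathbb{C}^m$ for which $\dim(H\cap\Gamma)=0$. *)

(* Defs.v *)
From HB Require Import structures.
From mathcomp Require Import all_boot all_order all_algebra.
From mathcomp Require Import complex.
From mathcomp Require Import all_classical all_reals all_analysis.
From mathcomp Require mpoly.
Import Order.TTheory GRing.Theory Num.Theory.
Import numFieldNormedType.Exports.

Set Implicit Arguments.
Unset Strict Implicit.
Unset Printing Implicit Defensive.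

Local Open Scope ring_scope.
Local Open Scope classical_set_scope.
Local Open Scope card_scope.

(* Packing R[i] as a numClosedFieldType lets the topology and the normed-module
   structure of numFieldNormedType be inferred on it. *)
Definition Cplx (R : realType) : numClosedFieldType := R[i]%C.

Definition cabs (R : realType) (z : Cplx R) : R := Normc.normc (z : R[i]%C).

Definition enorm (R : realType) (m : nat) (x : 'rV[Cplx R]_m) : R :=
  Num.sqrt (\sum_(i < m) cabs (x 0 i) ^+ 2).

Section PolynomialMaps.
Variables (R : realType) (m : nat).
Implicit Type g : 'I_m -> {poly Cplx R}.

Definition polymap g (t : Cplx R) : 'rV[Cplx R]_m := \row_j (g j).[t].

Definition poly_generic_injection g : Prop :=
  (exists s t, polymap g s <> polymap g t) /\
  exists Z : set 'rV[Cplx R]_m,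
    [/\ finite_set Z, Z `<=` range (polymap g) &
        {in ~` (polymap g @^-1` Z) &, injective (polymap g)}].

Definition polymap_deg g : nat := \max_(j < m) (size (g j)).-1.

End PolynomialMaps.

Section AlgebraicSets.
Variables (R : realType) (n : nat).
Implicit Types A B Z H : set 'rV[Cplx R]_n.

Definition zero_locus (k : nat) (ps : 'I_k -> mpoly.mpoly n (Cplx R)) :
    set 'rV[Cplx R]_n :=
  [set x | forall j, mpoly.meval (fun i => x 0 i) (ps j) = 0].

Definition algebraic A : Prop :=
  exists (k : nat) (ps : 'I_k -> mpoly.mpoly n (Cplx R)), A = zero_locus ps.

Definition zariski_closed_in A Z : Prop :=
  exists2 B, algebraic B & Z = A `&` B.

Definition zariski_irreducible Z : Prop :=
  Z !=set0 /\
  forall B1 B2, algebraic B1 -> algebraic B2 ->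
    Z `<=` B1 `|` B2 -> Z `<=` B1 \/ Z `<=` B2.

Definition irreducible_chain A (k : nat) : Prop :=
  exists Z : nat -> set 'rV[Cplx R]_n,
    (forall i, (i <= k)%N ->
       zariski_closed_in A (Z i) /\ zariski_irreducible (Z i)) /\
    (forall i, (i < k)%N -> Z i `<` Z i.+1).

(* Krull dimension for the induced Zariski topology; the empty set has no
   dimension in this sense. Excluding chains of length k.+1 excludes all
   longer ones by truncation. *)
Definition has_dim A (k : nat) : Prop :=
  irreducible_chain A k /\ ~ irreducible_chain A k.+1.

Definition affine_hyperplane H : Prop :=
  exists (a : 'rV[Cplx R]_n) (b : Cplx R),
    a != 0 /\ H = [set x | \sum_(i < n) a 0 i * x 0 i = b].

Definition is_projective_degree A (d : nat) : Prop :=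
  (exists H, [/\ affine_hyperplane H, has_dim (H `&` A) 0 &
                 H `&` A #= `I_d]) /\
  (forall H, affine_hyperplane H -> has_dim (H `&` A) 0 ->
     H `&` A #<= `I_d).

End AlgebraicSets.

Section FunctionsOnSets.
Variables (R : realType) (m : nat).
Implicit Types (A U : set 'rV[Cplx R]_m) (f : 'rV[Cplx R]_m -> Cplx R).

Definition slice (k : nat) : set 'rV[Cplx R]_m :=
  [set y | forall i : 'I_m, (k <= i)%N -> y 0 i = 0].

Definition slice_proj (k : nat) (y : 'rV[Cplx R]_m) : 'rV[Cplx R]_m :=
  \row_(i < m) (if (i < k)%N then y 0 i else 0).

(* Phi is a biholomorphism of the open set U onto the open set Phi(U), with
   inverse Psi, which straightens A inside U to a k-dimensional coordinate
   subspace. Differentiability is over the complex field, so that on an open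
   set it is holomorphy. *)
Definition flattening_chart A (k : nat) U
    (Phi Psi : 'rV[Cplx R]_m -> 'rV[Cplx R]_m) : Prop :=
  [/\ open U /\ open (Phi @` U),
      forall x, U x -> differentiable Phi x,
      forall y, (Phi @` U) y -> differentiable Psi y,
      forall x, U x -> Psi (Phi x) = x &
      Phi @` (A `&` U) = (Phi @` U) `&` slice k].

(* The points of A lying in the domain of some flattening chart are exactly
   the regular points of A. In a chart, f restricted to A is the function
   f \o Psi on an open subset of slice k; precomposing with slice_proj expresses
   its complex differentiability in the first k coordinates. *)
Definition holomorphic_on_regular A f : Prop :=
  forall k U Phi Psi, flattening_chart A k U Phi Psi ->
  forall a, A a -> U a -> differentiable (f \o Psi \o slice_proj k) (Phi a).

Definition c_holomorphic A f : Prop :=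
  {within A, continuous f} /\ holomorphic_on_regular A f.

Definition graph_on A f : set 'rV[Cplx R]_(m + 1) :=
  [set row_mx x (f x)%:M | x in A].

Definition growth_exponent A f : \bar R :=
  ereal_inf [set s%:E | s in [set s : R | 0 <= s /\
    exists C : R, 0 < C /\
      forall x, A x -> cabs (f x) <= C * (1 + enorm x) `^ s]].

Definition lojasiewicz_exponent_infty A f : \bar R :=
  ereal_sup [set l%:E | l in [set l : R | 0 < l /\
    exists C r : R, [/\ 0 < C, 0 < r &
      forall x, A x -> r <= enorm x -> C * enorm x `^ l <= cabs (f x)]]].

Definition is_geometric_degree A f (d : nat) : Prop :=
  exists2 E : set (Cplx R), finite_set E &
    forall w, ~ E w -> A `&` f @^-1` [set w] #= `I_d.

End FunctionsOnSets.

(* Main.v *)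
(** Put F := f o gamma. The equations of the graph of f, pulled back along
    gamma, are polynomials Q_j(t, w) whose common zeros are the points
    (t, F(t)). An element D of least w-degree in the ideal of the Q_j divides each of them up
    to powers of its leading coefficient l(t), so where l(t) <> 0 the only root
    of D(t, .) is F(t); comparing the two top coefficients of D(t, .) with those
    of l(t) (w - F(t))^k shows that F is rational, and being continuous it is a
    polynomial p. With n := deg p and N := deg gamma, |p(t)| is comparable to
    |t|^n and |gamma(t)| to |t|^N, so both exponents equal n / N. A generic
    fibre of p has n points, all simple and off the exceptional set of gamma,
    hence d(f) = n; the same argument for a coordinate of degree N produces a
    hyperplane section with N points, and a section with more points would be
    all of the irreducible infinite curve, which is not of dimension 0. *)
Require Import Defs.
From HB Require Import structures.
From mathcomp Require Import all_boot all_order all_algebra.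
From mathcomp Require Import complex.
From mathcomp Require Import all_classical all_reals all_analysis.
From mathcomp Require Import lra.
From mathcomp Require mpoly.
Import Order.TTheory GRing.Theory Num.Theory.
Import numFieldNormedType.Exports.

Local Open Scope ring_scope.
Local Open Scope classical_set_scope.

(** * Algebra and continuity *)

(** Take [D] nonzero of least size in the ideal of the [Q j]. Each pseudo-remainder of [Q j] by [D]
    stays in the ideal and is smaller than [D], so it vanishes. *)
Lemma ideal_pseudo_generator (K : idomainType) (k : nat)
    (Q : 'I_k -> {poly K}) :
  (exists j, Q j != 0) ->
  exists (D : {poly K}) (A : 'I_k -> {poly K}),
    [/\ D != 0, D = \sum_j A j * Q j &
        forall j, exists (e : nat) (B : {poly K}),
          lead_coef D ^+ e *: Q j = B * D].
Proof.
move=> [j0 Qj0].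
pose isz n := `[< exists A : 'I_k -> {poly K},
  \sum_j A j * Q j != 0 /\ size (\sum_j A j * Q j) = n >].
have deltaE j : \sum_i (i == j)%:R * Q i = Q j.
  rewrite (bigD1 j)//= eqxx mul1r big1 ?addr0// => i /negbTE ->.
  by rewrite mul0r.
have ex : exists n, isz n.
  exists (size (Q j0)); apply/asboolP; exists (fun i => (i == j0)%:R).
  by rewrite deltaE.
case: (ex_minnP ex) => n /asboolP[A [D0 sD]] minn.
set D := \sum_j A j * Q j in D0 sD.
exists D, A; split => // j.
exists (scalp (Q j) D), (Q j %/ D)%R.
have /eqP := Pdiv.Idomain.divp_eq (Q j) D.
have [->|r0] := eqVneq (Q j %% D)%R 0; first by rewrite addr0 => /eqP.
move=> /eqP eqr; exfalso.
have : (size (Q j %% D)%R < n)%N by rewrite -sD ltn_modp.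
rewrite ltnNge => /negP; apply; apply: minn; apply/asboolP.
pose c := lead_coef D ^+ scalp (Q j) D.
(* The remainder is [c Q_j - (Q_j %/ D) D]; expanding [D] over the [Q i] gives these
   coefficients. *)
exists (fun i => (c%:P * (i == j)%:R - (Q j %/ D)%R * A i)%R).
suff -> : \sum_i (c%:P * (i == j)%:R - (Q j %/ D)%R * A i) * Q i =
  (Q j %% D)%R by [].
under eq_bigr do rewrite mulrBl -!mulrA.
by rewrite sumrB -!mulr_sumr deltaE mul_polyC /c eqr -/D addrC addKr.
Qed.

(** Over a closed field [h] is [lead_coef h] times a power of [X - z], and Vieta's formula gives the
    sum of its roots as the degree times [z]. As [size] is the degree plus one, [.-2] is the index
    just below the leading one. *)
Lemma coef_single_root (C : closedFieldType) (h : {poly C}) (z : C) :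
  (1 < size h)%N -> (forall w, root h w -> w = z) ->
  h`_(size h).-2 = - (lead_coef h * z *+ (size h).-1).
Proof.
move=> sh hz; have [r hE] := closed_field_poly_normal h.
have lc0 : lead_coef h != 0 by rewrite lead_coef_eq0 -size_poly_gt0 ltnW.
have rz w : w \in r -> w = z.
  by move=> wr; apply: hz; rewrite hE rootZ// root_prod_XsubC.
have sr : (size h).-1 = size r.
  by rewrite [in LHS]hE size_scale// size_prod_XsubC.
have r0 : size r != 0 by rewrite -sr -lt0n -subn1 subn_gt0.
have -> : h`_(size h).-2 =
    (lead_coef h *: \prod_(w <- r) ('X - w%:P))`_(size r).-1.
  by rewrite -hE sr.
rewrite sr coefZ.
have -> : (\prod_(z0 <- r) ('X - z0%:P))`_(size r).-1 = - (z *+ size r).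
  rewrite coefPn_prod_XsubC//; congr (- _).
  by rewrite (eq_big_seq (fun=> z))// big_const_seq count_predT iter_addr_0.
by rewrite mulrN mulrnAr.
Qed.

Lemma continuous_poly (K : numFieldType) (p : {poly K}) :
  continuous (fun t : K => p.[t]).
Proof.
elim/poly_ind: p => [|p c IH].
  have -> : (fun t => 0.[t]) = (cst 0 : K -> K).
    by apply/funext => u; rewrite horner0.
  exact: cst_continuous.
have -> : (fun t => (p * 'X + c%:P).[t]) = (fun t => p.[t] * t + c).
  by apply/funext => u; rewrite !hornerE.
move=> t.
apply: (@cvgD K K K (nbhs (t : K)) _ (fun t => p.[t] * t) (cst c)).
  apply: (@cvgM K K (nbhs (t : K)) _ (horner p) id); first exact: IH.
  exact: cvg_id.
exact: cvg_cst.
Qed.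

(** Every punctured neighbourhood filter eventually avoids [S], so [F] and [G] have the same limit
    at each point, including the points of [S]. *)
Lemma continuous_eq_off_finite (K : numFieldType) (F G : K -> K) (S : seq K) :
  continuous F -> continuous G -> (forall t, t \notin S -> F t = G t) ->
  F =1 G.
Proof.
move=> cF cG FG t.
have nS : \forall s \near t^', s \notin S.
  elim: (S) => [|x S' IH]; first by near=> s.
  have nx : \forall s \near t^', s != x.
    have [->|tx] := eqVneq t x; first exact: nbhs_dnbhs_neq.
    apply: nbhs_dnbhs.
    suff : open_nbhs t (~` [set x]).
      by move/open_nbhs_nbhs; apply: filterS => s /eqP.
    split; last exact/eqP.
    apply: closed_openC; apply: accessible_closed_set1.
    exact/hausdorff_accessible/norm_hausdorff.
  apply: filterS2 nx IH => s sx sS'.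
  by rewrite inE negb_or sx.
have cvg_dn (H : K -> K) : continuous H -> H s @[s --> t^'] --> H t.
  by move=> cH; apply/continuous_withinNx/cH.
apply: (@cvg_unique _ (@norm_hausdorff _ K) (F @ t^')).
- exact: cvg_dn.
- apply: cvg_trans (cvg_dn _ cG); apply: near_eq_cvg.
  by apply: filterS nS => s /FG ->.
Unshelve. all: by end_near. Qed.

(** Induction on the size of [a]. A root [z] of [a] is also a root of [b]; cancelling [X - z] on
    both sides keeps the identity off [z], and continuity restores it at [z]. *)
Lemma rational_continuous_poly (K : numClosedFieldType) (F : K -> K)
    (a b : {poly K}) :
  continuous F -> a != 0 -> (forall t, a.[t] * F t = b.[t]) ->
  exists p : {poly K}, forall t, F t = p.[t].
Proof.
move=> cF; have [n] := ubnP (size a).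
elim: n a b => // n IH a b; rewrite ltnS => san a0 aF.
have [sa|sa] := leqP (size a) 1.
  have aE := size1_polyC sa.
  have c0 : a`_0 != 0 by apply: contraNneq a0 => a00; rewrite aE a00.
  exists ((a`_0)^-1 *: b) => t.
  by rewrite hornerZ -aF [in a.[t]]aE hornerC mulKf.
have [z /factor_theorem[a' aE]] := closed_rootP a (negbT (gtn_eqF sa)).
have bz : root b z by rewrite rootE -aF aE !hornerE subrr mulr0 mul0r.
have /factor_theorem[b' bE] := bz.
have a'0 : a' != 0 by apply: contraNneq a0 => a'0; rewrite aE a'0 mul0r.
apply: (IH a' b') => //.
  by move: san; rewrite aE size_Mmonic ?monicXsubC// size_XsubC addn2 -ltnS.
apply: (@continuous_eq_off_finite _
  (fun t => a'.[t] * F t) (fun t => b'.[t]) [:: z]).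
- move=> t; apply: (@cvgM K K (nbhs (t : K)) _ (horner a') F).
    exact: continuous_poly.
  exact: cF.
- exact: continuous_poly.
- move=> t; rewrite inE => tz.
  apply: (@mulIf _ (t - z)); first by rewrite subr_eq0.
  move: (aF t); rewrite aE bE !hornerE => <-.
  by rewrite -!mulrA; congr (_ * _); rewrite mulrC.
Qed.

Lemma rmorph_mmap (n : nat) (K S : comNzRingType) (c : K -> S)
    (h : 'I_n -> S) (phi : {rmorphism S -> K}) (P : mpoly.mpoly n K) :
  cancel c phi ->
  phi (mpoly.mmap c h P) = mpoly.meval (phi \o h) P.
Proof.
move=> cK; rewrite /mpoly.mmap rmorph_sum /mpoly.meval /mpoly.mmap.
apply: eq_bigr => i _; rewrite rmorphM /= cK; congr (_ * _).
by rewrite /mpoly.mmap1 rmorph_prod; apply: eq_bigr => j _; rewrite rmorphXn.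
Qed.

Lemma poly_roots_seq (C : closedFieldType) (p : {poly C}) :
  p != 0 -> exists s : seq C, forall t, root p t = (t \in s).
Proof.
move=> p0; have [s pE] := closed_field_poly_normal p; exists s => t.
by rewrite pE rootZ ?lead_coef_eq0// root_prod_XsubC.
Qed.

Lemma poly_nonroot (C : numClosedFieldType) (p : {poly C}) :
  p != 0 -> exists t, p.[t] != 0.
Proof.
move=> p0; apply: contrapT => H.
(* In characteristic zero these are [size p] distinct elements, one more than the degree allows as
   roots. *)
pose s : seq C := [seq i%:R | i <- iota 0 (size p)].
have us : uniq s.
  by rewrite map_inj_uniq ?iota_uniq// => i j /eqP; rewrite eqr_nat => /eqP.
have : all (root p) s.
  apply/allP => t _; apply: contrapT => /negP nr; apply: H; exists t.
  by rewrite -rootE.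
by move=> /(max_poly_roots p0)/(_ us); rewrite size_map size_iota ltnn.
Qed.

(** * Polynomiality of the function along the parametrisation *)

Section GraphPolynomial.
Variables (R : realType) (m : nat) (g : 'I_m -> {poly Cplx R}).
Variable f : 'rV[Cplx R]_m -> Cplx R.
Local Notation C := (Cplx R).
Local Notation Gamma := (range (polymap g)).

Lemma continuous_polymap : continuous (polymap g).
Proof.
move=> t A [P nP PA].
have nj j : nbhs (t : C) (fun s => P 0 j (g j).[s]).
  by have := nP 0 j; rewrite mxE; exact: continuous_poly.
have : nbhs (t : C) (fun s => forall j, P 0 j (g j).[s]).
  exact: (@filter_forall _ _ (fun j s => P 0 j (g j).[s]) (nbhs (t : C)) _ nj).
by apply: filterS => s Ps; apply: PA => i j; rewrite mxE (ord1 i).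
Qed.

Lemma continuous_comp_polymap :
  {within Gamma, continuous f} -> continuous (fun t => f (polymap g t)).
Proof.
move=> /subspace_continuousP cf t.
apply: cvg_trans (cf (polymap g t) _); last by exists t.
move=> A /= wA.
have : nbhs (t : C) (polymap g @^-1` (fun x => Gamma x -> A (f x))).
  exact: (@continuous_polymap t _ wA).
by move=> nA; apply: filterS nA => s /=; apply; exists s.
Qed.

Lemma graph_onE (t w : C) :
  graph_on Gamma f (row_mx (polymap g t) w%:M) <-> w = f (polymap g t).
Proof.
split=> [[x _ /eq_row_mx[<- /matrixP/(_ 0 0)]]|->].
  by rewrite !mxE eqxx !mulr1n.
by exists (polymap g t) => //; exists t.
Qed.

Lemma algebraic_graph_poly :
  {within Gamma, continuous f} -> algebraic (graph_on Gamma f) ->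
  exists p : {poly C}, forall t, f (polymap g t) = p.[t].
Proof.
move=> /continuous_comp_polymap cF [k [ps graphE]].
set F := fun t => f (polymap g t) in cF *.
(* The inner variable is [t], the outer one [w]: the first [m] coordinates become [g j] in [t], the
   last becomes [w]. *)
pose h (i : 'I_(m + 1)) : {poly {poly C}} :=
  match fintype.split i with inl j => (g j)%:P | inr _ => 'X end.
pose Q j := mpoly.mmap (polyC \o polyC) h (ps j).
have QE (t w : C) j : (Q j).[w%:P].[t] =
    mpoly.meval (fun i => (row_mx (polymap g t) w%:M) 0 i) (ps j).
  have := @rmorph_mmap _ _ _ (polyC \o polyC) h
    (horner_eval t \o horner_eval w%:P) (ps j).
  rewrite /= /horner_eval -/(Q j) => -> => [|c]; last by rewrite /= !hornerC.
  apply: mpoly.meval_eq => i; rewrite /= mxE /h.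
  case: fintype.split => j'; rewrite ?hornerC ?hornerX ?mxE ?hornerC//.
  by rewrite (ord1 j') mulr1n.
have rootQ (t w : C) : (forall j, (Q j).[w%:P].[t] = 0) <-> w = F t.
  rewrite /F -graph_onE graphE; split=> H j; first by rewrite -QE.
  by rewrite QE; exact: H.
(* If all [Q j] were zero, every [w] would equal [F 0], in particular [F 0 + 1]. *)
have /ideal_pseudo_generator[D [A [D0 DE BE]]] : exists j, Q j != 0.
  apply: contrapT => H; suff /eqP : F 0 + 1 = F 0.
    by rewrite -subr_eq0 addrC addKr oner_eq0.
  apply/rootQ => j; have [->|Qj] := eqVneq (Q j) 0; first by rewrite !horner0.
  by exfalso; apply: H; exists j.
pose Dt t := map_poly (horner_eval t) D.
have DtE t w : (Dt t).[w] = D.[w%:P].[t].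
  rewrite -[RHS]/(horner_eval t D.[w%:P]) -horner_map /=.
  by rewrite /horner_eval hornerC.
have rootD t w : (lead_coef D).[t] != 0 -> root (Dt t) w <-> w = F t.
  move=> lt0; split=> [/rootP|->].
    rewrite DtE => Dw; apply/rootQ => j.
    have [e [B /(congr1 (fun p => p.[w%:P].[t]))]] := BE j.
    rewrite hornerZ !hornerM Dw mulr0 horner_exp => /eqP.
    by rewrite mulf_eq0 expf_eq0 (negbTE lt0) andbF => /eqP.
  apply/rootP; rewrite DtE DE !horner_sum big1// => j _.
  by rewrite !hornerM (iffRL (rootQ t (F t)) erefl j) mulr0.
have sDt t : (lead_coef D).[t] != 0 -> size (Dt t) = size D.
  by move=> lt0; rewrite size_map_poly_id0.
have lD0 : lead_coef D != 0 by rewrite lead_coef_eq0.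
have sD : (1 < size D)%N.
  have [t lt0] := poly_nonroot _ _ lD0.
  rewrite -(sDt _ lt0); apply: (@root_size_gt1 _ (F t)).
    by rewrite -size_poly_gt0 sDt// size_poly_gt0.
  exact/rootD.
(* Where the leading coefficient does not vanish at [t], [F t] is the only root of [Dt t], so
   [coef_single_root] reads [a.[t] * F t = b.[t]]. *)
pose a := lead_coef D *+ (size D).-1.
pose b := - D`_(size D).-2.
have [r rE] := poly_roots_seq _ _ lD0.
apply: (@rational_continuous_poly _ F a b) => //.
  rewrite /a -mulr_natr mulf_neq0// -polyC_natr polyC_eq0 pnatr_eq0 -lt0n.
  by rewrite -subn1 subn_gt0.
apply: (@continuous_eq_off_finite _ (fun t => a.[t] * F t) (fun t => b.[t]) r).
- move=> t; apply: (@cvgM C C (nbhs (t : C)) _ (horner a) F).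
    exact: continuous_poly.
  exact: cF.
- exact: continuous_poly.
- move=> t; rewrite -rE rootE => lt0.
  have := @coef_single_root _ (Dt t) (F t).
  rewrite sDt// lead_coef_map_eq// coef_map /= /horner_eval => /(_ sD) H.
  rewrite /a /b hornerMn hornerN H ?opprK ?mulrnAl//.
  by move=> w /(rootD _ _ lt0).
Qed.
End GraphPolynomial.

(** * Growth of polynomial maps *)

Section Cabs.
Variable R : realType.
Local Notation C := (Cplx R).
Implicit Types (z w t : C) (p : {poly C}).

Lemma cabs_ge0 z : 0 <= cabs z.
Proof. by case: z => a b; exact: sqrtr_ge0. Qed.

Lemma cabsM z w : cabs (z * w) = cabs z * cabs w.
Proof. exact: Normc.normcM. Qed.

Lemma ler_cabsD z w : cabs (z + w) <= cabs z + cabs w.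
Proof. exact: le_normcD. Qed.

Lemma cabsN z : cabs (- z) = cabs z.
Proof. exact: normcN. Qed.

Lemma cabs_gt0 z : z != 0 -> 0 < cabs z.
Proof.
move=> z0; rewrite lt_neqAle cabs_ge0 andbT eq_sym.
by apply: contraNneq z0 => /Normc.eq0_normc ->.
Qed.

Lemma cabs_real (r : R) : 0 <= r -> cabs (r%:C)%C = r.
Proof. by move=> r0; rewrite /cabs /= expr0n addr0 sqrtr_sqr ger0_norm. Qed.

(** Induction along Horner's scheme. Powers of [1 + cabs t], being at least 1, absorb constants, so
    the bound holds for all [t]. *)
Lemma cabs_poly_upper p :
  exists2 A : R, 0 < A &
    forall t, cabs p.[t] <= A * (1 + cabs t) ^+ (size p).-1.
Proof.
elim/poly_ind: p => [|q c [A A0 IH]].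
  exists 1 => // t; rewrite horner0 size_poly0 expr0 mulr1.
  by rewrite /cabs Normc.normc0.
rewrite size_MXaddC; have [q0|q0] /= := eqVneq q 0.
  exists (cabs c + 1); first by rewrite ltr_wpDl// cabs_ge0.
  move=> t; rewrite q0 mul0r add0r hornerC.
  have -> : (if c == 0 then 0%N else (size (0 : {poly C})).+1).-1 = 0%N.
    by case: ifP; rewrite ?size_poly0.
  by rewrite expr0 mulr1 lerDl.
exists (A + cabs c) => [|t]; first by rewrite ltr_wpDr// cabs_ge0.
rewrite !hornerE (le_trans (ler_cabsD _ _))// cabsM mulrDl.
have T1 : 1 <= 1 + cabs t by rewrite lerDl cabs_ge0.
apply: lerD; last by rewrite ler_peMr ?cabs_ge0// exprn_ege1.
rewrite -[size q]prednK ?size_poly_gt0// exprSr mulrA.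
by rewrite ler_pM ?cabs_ge0// lerDr.
Qed.

Lemma cabs_poly_lower p : p != 0 ->
  exists a r : R, [/\ 0 < a, 1 <= r &
    forall t, r <= 1 + cabs t -> a * (1 + cabs t) ^+ (size p).-1 <= cabs p.[t]].
Proof.
elim/poly_ind: p => [|q c IH p0]; first by rewrite eqxx.
rewrite size_MXaddC; have [q0|q0] /= := eqVneq q 0.
  move: p0; rewrite q0 mul0r add0r polyC_eq0 => c0.
  exists (cabs c), 1; rewrite cabs_gt0//; split => // t _.
  by rewrite hornerC (negbTE c0) size_poly0 expr0 mulr1.
have [a [r [a0 r1 Ht]]] := IH q0.
(* With [T = 1 + cabs t] and [n] the degree of [q]: [T >= 2] gives [cabs t >= T / 2], so [q * 'X]
   contributes at least [a / 2 * T ^+ n.+1]; [T >= 4 * cabs c / a] keeps [cabs c] below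
   [a / 4 * T ^+ n.+1]. *)
exists (a / 4), (r + 2 + 4 * cabs c / a); split; first by rewrite divr_gt0.
  have := cabs_ge0 c; have : 0 <= 4 * cabs c / a.
    by rewrite divr_ge0 ?mulr_ge0 ?cabs_ge0// ltW.
  by move: r1; lra.
move=> t rt.
set T := 1 + cabs t in rt Ht *; set n := (size q).-1 in Ht *.
have ca0 : 0 <= 4 * cabs c / a by rewrite divr_ge0 ?mulr_ge0 ?cabs_ge0// ltW.
have T1 : 1 <= T by rewrite /T lerDl cabs_ge0.
have /Ht qT : r <= T by move: rt ca0; lra.
have -> : size q = n.+1 by rewrite prednK// size_poly_gt0.
rewrite !hornerE.
have tri : cabs t * cabs q.[t] <= cabs (q.[t] * t + c) + cabs c.
  rewrite mulrC -cabsM -(cabsN c); apply: le_trans (ler_cabsD _ _).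
  by rewrite addrK.
have tT : T / 2 <= cabs t by move: rt ca0 r1; rewrite /T; lra.
have h1 : T / 2 * (a * T ^+ n) <= cabs t * cabs q.[t].
  by rewrite ler_pM// ?mulr_ge0 ?exprn_ge0 ?divr_ge0// ?(ltW a0)//; lra.
have h2 : cabs c <= a / 4 * T ^+ n.+1.
  have : 4 * cabs c / a <= T ^+ n.+1.
    apply: (@le_trans _ _ T); first by move: rt r1; lra.
    by rewrite -{1}(expr1 T) ler_weXn2l.
  by rewrite ler_pdivrMr// => ?; lra.
have h3 : T / 2 * (a * T ^+ n) = a / 2 * T ^+ n.+1 by rewrite exprS; lra.
lra.
Qed.

End Cabs.

(** * Size of the parametrised points *)

Section Enorm.
Variables (R : realType) (m : nat) (g : 'I_m -> {poly Cplx R}).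
Local Notation C := (Cplx R).

Lemma cabs_le_enorm (x : 'rV[C]_m) j : cabs (x 0 j) <= enorm x.
Proof.
rewrite /enorm -[leLHS]ger0_norm ?cabs_ge0// -sqrtr_sqr ler_wsqrtr//.
rewrite (bigD1 j)//= lerDl sumr_ge0// => i _; exact: sqr_ge0.
Qed.

Lemma enorm_ge0 (x : 'rV[C]_m) : 0 <= enorm x.
Proof. exact: sqrtr_ge0. Qed.

Lemma enorm_le (x : 'rV[C]_m) (B : R) : 0 <= B ->
  (forall j, cabs (x 0 j) <= B) -> enorm x <= Num.sqrt m%:R * B.
Proof.
move=> B0 xB; rewrite /enorm -[B in leRHS]ger0_norm// -sqrtr_sqr -sqrtrM//.
rewrite ler_wsqrtr// (@le_trans _ _ (\sum_(i < m) B ^+ 2))//.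
  by apply: ler_sum => i _; rewrite ler_sqr ?nnegrE ?cabs_ge0.
by rewrite sumr_const card_ord mulr_natl.
Qed.

Local Notation N := (polymap_deg g).

Lemma enorm_polymap_upper :
  exists2 A : R, 0 < A &
    forall t, enorm (polymap g t) <= A * (1 + cabs t) ^+ N.
Proof.
have /choice[A HA] : forall j, exists A : R, 0 < A /\
    forall t, cabs (g j).[t] <= A * (1 + cabs t) ^+ (size (g j)).-1.
  by move=> j; have [A] := cabs_poly_upper _ (g j); exists A.
pose B := \sum_j A j.
have B0 : 0 <= B by apply: sumr_ge0 => j _; rewrite ltW// (HA j).1.
(* The added 1 keeps the constant positive when [m = 0]. *)
exists (Num.sqrt m%:R * B + 1); first by rewrite ltr_wpDl// mulr_ge0.
move=> t; have T1 : 1 <= 1 + cabs t by rewrite lerDl cabs_ge0.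
have TN : 0 <= (1 + cabs t) ^+ N by rewrite exprn_ge0// (le_trans _ T1).
rewrite mulrDl ler_wpDr ?mul1r// -mulrA.
apply: enorm_le => [|j]; first exact: mulr_ge0.
rewrite mxE (le_trans ((HA j).2 t))// ler_pM ?exprn_ge0 ?(ltW (HA j).1)//.
- exact: le_trans T1.
- rewrite /B (bigD1 j)//= lerDl sumr_ge0// => i _; exact: ltW (HA i).1.
- rewrite ler_weXn2l//; exact: (@leq_bigmax _ (fun j => (size (g j)).-1)).
Qed.

Lemma leq_polymap_deg j : ((size (g j)).-1 <= N)%N.
Proof. exact: (@leq_bigmax _ (fun j => (size (g j)).-1)). Qed.

Lemma polymap_deg_attained : (0 < N)%N -> exists j, (size (g j)).-1 = N.
Proof.
move=> N0; apply: contrapT => H.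
suff : (N <= N.-1)%N by rewrite leqNgt prednK ?leqnn.
apply/bigmax_leqP => j _.
have := leq_polymap_deg j; rewrite leq_eqVlt => /orP[/eqP e|].
  by exfalso; apply: H; exists j.
by rewrite -{1}(prednK N0) ltnS.
Qed.

Lemma enorm_polymap_lower : (0 < N)%N ->
  exists2 a : R, 0 < a &
    forall t, a * (1 + cabs t) ^+ N <= 1 + enorm (polymap g t).
Proof.
move=> N0; have [j jN] := polymap_deg_attained N0.
have gj0 : g j != 0 by apply: contraTneq N0 => e; rewrite -jN e size_poly0.
have [a [r [a0 r1 Ha]]] := cabs_poly_lower _ _ gj0.
have r0 : 0 < r by exact: lt_le_trans r1.
(* A coordinate of degree [N] gives the bound for [1 + cabs t >= r]. Below [r] the second entry
   makes the left side at most 1. *)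
exists (Num.min a (r ^+ N)^-1).
  by rewrite lt_min a0 invr_gt0 exprn_gt0.
move=> t; have T0 : 0 <= 1 + cabs t by rewrite addr_ge0 ?cabs_ge0.
have [rT|Tr] := leP r (1 + cabs t).
  rewrite (@le_trans _ _ (a * (1 + cabs t) ^+ N))//.
    by rewrite ler_wpM2r ?exprn_ge0// ge_min lexx.
  rewrite -jN (le_trans (Ha _ rT))//.
  have := cabs_le_enorm (polymap g t) j; rewrite mxE => h.
  by rewrite (le_trans h)// lerDr.
rewrite (@le_trans _ _ ((r ^+ N)^-1 * (1 + cabs t) ^+ N))//.
  by rewrite ler_wpM2r ?exprn_ge0// ge_min lexx orbT.
rewrite (@le_trans _ _ 1) ?lerDl ?enorm_ge0//.
by rewrite ler_pdivrMl ?exprn_gt0// mulr1 lerXn2r ?nnegrE// ltW.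
Qed.

End Enorm.

(** * Comparison of real powers *)

Section Exponents.
Variable R : realType.

Lemma powR_natmul (T x : R) (n : nat) :
  0 <= T -> (T ^+ n) `^ x = T `^ (n%:R * x).
Proof. by move=> T0; rewrite powRrM powR_mulrn. Qed.

Lemma powR_asymptotic_le (a A r x y : R) : 0 < a ->
  (forall T, r <= T -> 1 <= T -> a * T `^ x <= A * T `^ y) -> x <= y.
Proof.
move=> a0 H; rewrite leNgt; apply/negP => yx.
have d0 : 0 < x - y by rewrite subr_gt0.
have K0 : 0 <= `|A| / a by rewrite divr_ge0// ltW.
(* This makes [T] to the power [x - y] at least [|A| / a + 1], so that [a] times it exceeds [A]. *)
pose T := Num.max (Num.max r 1) ((`|A| / a + 1) `^ (x - y)^-1).
have rT : r <= T by rewrite /T !le_max lexx.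
have T1 : 1 <= T by rewrite /T !le_max lexx orbT.
have T0 : 0 < T by exact: lt_le_trans T1.
have KT : `|A| / a + 1 <= T `^ (x - y).
  have -> : `|A| / a + 1 = ((`|A| / a + 1) `^ (x - y)^-1) `^ (x - y).
    by rewrite -powRrM mulVf ?lt0r_neq0// powRr1// addr_ge0.
  apply: ge0_ler_powR; rewrite ?nnegrE ?powR_ge0 ?(ltW d0) ?(ltW T0)//.
  by rewrite /T le_max lexx orbT.
have := H T rT T1; rewrite -{1}(subrK y x) powRD; last first.
  by rewrite subrK lt0r_neq0// implybT.
rewrite mulrA ler_pM2r ?powR_gt0// => aA.
have : a * (`|A| / a + 1) <= A by rewrite (le_trans _ aA)// ler_wpM2l// ltW.
rewrite mulrDr mulrCA divff ?lt0r_neq0// !mulr1.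
by move: (ler_norm A) a0; lra.
Qed.

End Exponents.

(** * The two exponents of the curve *)

Section CurveExponents.
Variables (R : realType) (m : nat) (g : 'I_m -> {poly Cplx R}).
Variables (f : 'rV[Cplx R]_m -> Cplx R) (p : {poly Cplx R}).
Hypothesis fE : forall t, f (polymap g t) = p.[t].
Local Notation Gamma := (range (polymap g)).
Local Notation N := (polymap_deg g).
Local Notation n := (size p).-1.
Hypotheses (N0 : (0 < N)%N) (n0 : (0 < n)%N).

Let p0 : p != 0.
Proof. by apply: contraTneq n0 => ->; rewrite size_poly0. Qed.

(** Turns estimates in [t] into the inequalities between real powers required by
    [powR_asymptotic_le]. *)
Let cabs_surj (T : R) : 1 <= T -> exists t : Cplx R, 1 + cabs t = T.
Proof.
move=> T1; exists ((T - 1)%:C)%C.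
by rewrite cabs_real ?subr_ge0// addrC subrK.
Qed.

Let NnN : N%:R * (n%:R / N%:R) = n%:R :> R.
Proof. by rewrite mulrC divfK// pnatr_eq0 -lt0n. Qed.

Let s0 : 0 < n%:R / N%:R :> R.
Proof. by rewrite divr_gt0 ?ltr0n. Qed.

Let T1 (t : Cplx R) : 1 <= 1 + cabs t.
Proof. by rewrite lerDl cabs_ge0. Qed.

Let T0 (t : Cplx R) : 0 <= 1 + cabs t.
Proof. exact: le_trans (T1 t). Qed.

Let TnE (t : Cplx R) :
  (1 + cabs t) ^+ n = ((1 + cabs t) ^+ N) `^ (n%:R / N%:R).
Proof. by rewrite powR_natmul// NnN powR_mulrn. Qed.

Lemma growth_exponentE : growth_exponent Gamma f = (n%:R / N%:R)%:E.
Proof.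
have [A A0 EA] := enorm_polymap_upper _ _ g.
have [a a0 Ea] := enorm_polymap_lower _ _ g N0.
have [B B0 PB] := cabs_poly_upper _ p.
have [b [r [b0 r1 Pb]]] := cabs_poly_lower _ _ p0.
apply/eqP; rewrite eq_le; apply/andP; split.
  apply: ereal_inf_lbound; exists (n%:R / N%:R) => //.
  split; first exact: ltW.
  (* With [T = 1 + cabs t], [|p(t)|] is at most [B] times the power [n / N] of [T ^+ N], and
     [T ^+ N] is at most [a^-1] times [1 + enorm]. *)
  exists (B * a^-1 `^ (n%:R / N%:R)); split.
    by rewrite mulr_gt0// powR_gt0// invr_gt0.
  move=> _ [t _ <-].
  rewrite fE (le_trans (PB t))// -mulrA ler_wpM2l ?(ltW B0)//.
  have E0 : 0 <= 1 + enorm (polymap g t) by rewrite addr_ge0 ?enorm_ge0.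
  rewrite -powRM ?invr_ge0 ?(ltW a0)//.
  rewrite TnE; apply: ge0_ler_powR; rewrite ?nnegrE ?exprn_ge0// ?(ltW s0)//.
    by rewrite mulr_ge0// invr_ge0 ltW.
  by rewrite ler_pdivlMl.
apply: le_ereal_inf_tmp => _ [s [s_ge0 [C [C0 Cs]]] <-].
rewrite lee_fin ler_pdivrMr ?ltr0n// mulrC.
(* An admissible [s] bounds [b * T ^+ n] by a constant times [T] to the power [N * s], as
   [1 + A * T ^+ N <= (1 + A) * T ^+ N]; hence [n <= N * s]. *)
apply: (@powR_asymptotic_le _ b (C * (1 + A) `^ s) r) => // T rT T_1.
have [t tT] := cabs_surj _ T_1.
have T_0 : 0 <= T by exact: le_trans T_1.
have PbT : b * T ^+ n <= cabs (f (polymap g t)).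
  by rewrite fE -tT; apply: Pb; rewrite tT.
rewrite powR_mulrn// (le_trans PbT)//.
have Gt : Gamma (polymap g t) by exists t.
rewrite (le_trans (Cs _ Gt))//.
rewrite -mulrA ler_wpM2l ?(ltW C0)// -powR_natmul//.
rewrite -powRM ?exprn_ge0 ?addr_ge0 ?(ltW A0)//.
apply: ge0_ler_powR;
  rewrite ?nnegrE ?mulr_ge0 ?addr_ge0 ?enorm_ge0 ?exprn_ge0 ?(ltW A0)//.
by rewrite mulrDl mul1r lerD// ?exprn_ege1// -tT EA.
Qed.

Lemma lojasiewicz_exponent_inftyE :
  lojasiewicz_exponent_infty Gamma f = (n%:R / N%:R)%:E.
Proof.
have [A A0 EA] := enorm_polymap_upper _ _ g.
have [a a0 Ea] := enorm_polymap_lower _ _ g N0.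
have [B B0 PB] := cabs_poly_upper _ p.
have [b [r [b0 r1 Pb]]] := cabs_poly_lower _ _ p0.
have r0 : 0 <= r by exact: le_trans r1.
apply/eqP; rewrite eq_le; apply/andP; split; last first.
  apply: ereal_sup_ubound; exists (n%:R / N%:R) => //.
  split => //; have As : 0 < A `^ (n%:R / N%:R) by rewrite powR_gt0.
  (* By the upper bound on [enorm], this threshold forces [1 + cabs t >= r], where the lower bound
     on [p] applies. *)
  exists (b / A `^ (n%:R / N%:R)), (A * r ^+ N + 1); split.
  - by rewrite divr_gt0.
  - by rewrite ltr_wpDl// mulr_ge0 ?exprn_ge0// ltW.
  move=> _ [t _ <-] Er.
  have rT : r <= 1 + cabs t.
    rewrite leNgt; apply/negP => Tr.
    have : A * (1 + cabs t) ^+ N <= A * r ^+ N.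
      by rewrite ler_wpM2l ?(ltW A0)// lerXn2r ?nnegrE// ltW.
    by move: Er (EA t); lra.
  rewrite fE (le_trans _ (Pb t rT))// mulrAC ler_pdivrMr// -mulrA.
  rewrite ler_wpM2l ?(ltW b0)//.
  rewrite TnE -powRM ?exprn_ge0 ?(ltW A0)//.
  apply: ge0_ler_powR; rewrite ?nnegrE ?enorm_ge0 ?(ltW s0)//.
    by rewrite mulr_ge0 ?exprn_ge0// ltW.
  by rewrite mulrC.
apply: ge_ereal_sup => _ [l [l0 [C [rho [C0 rho0 Cl]]]] <-].
rewrite lee_fin ler_pdivlMr ?ltr0n// mulrC.
have a20 : 0 < a / 2 by rewrite divr_gt0.
(* For such [T], half of [a * T ^+ N] covers [1 + rho]: thus [enorm] is at least both
   [a / 2 * T ^+ N] and [rho]. *)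
apply: (@powR_asymptotic_le _ (C * (a / 2) `^ l) B ((1 + rho) / (a / 2))).
  by rewrite mulr_gt0// powR_gt0.
move=> T rT T_1; have [t tT] := cabs_surj _ T_1.
have T_0 : 0 <= T by exact: le_trans T_1.
have TN : T <= T ^+ N by rewrite -{1}(expr1 T) ler_weXn2l.
have aT : 1 + rho <= a / 2 * T ^+ N.
  move: rT; rewrite ler_pdivrMr// mulrC => /le_trans; apply.
  by rewrite ler_wpM2l// ltW.
have := Ea t; rewrite tT => EaT.
have El : a / 2 * T ^+ N <= enorm (polymap g t) by move: aT EaT rho0; lra.
have := Cl (polymap g t); rewrite fE => /(_ (ex_intro2 _ _ t I erefl)) H.
rewrite [X in _ <= _ * X]powR_mulrn// -tT (le_trans _ (PB t))//.
have {}/H H : rho <= enorm (polymap g t) by move: aT El; lra.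
rewrite (le_trans _ H)//.
rewrite tT -mulrA ler_wpM2l ?(ltW C0)// -powR_natmul//.
rewrite -powRM ?exprn_ge0 ?(ltW a20)//.
apply: ge0_ler_powR; rewrite ?nnegrE ?enorm_ge0 ?(ltW l0)//.
by rewrite mulr_ge0 ?exprn_ge0// ltW.
Qed.

End CurveExponents.

(** * Degrees *)

Lemma card_uniq_seq (T : choiceType) (s : seq T) :
  uniq s -> ([set` s] #= `I_(size s))%card.
Proof.
elim: s => [_|x s IH /= /andP[xs /IH us]].
  by rewrite set_nil II0 card_eq00.
apply/eq_cardSP; exists x => /=; first by rewrite inE eqxx.
suff -> : [set` x :: s] `\ x = [set` s] by [].
apply/seteqP; split => y /=; rewrite inE.
  by move=> [/orP[/eqP|]].
by move=> ys; split; [rewrite ys orbT|move=> yx; rewrite -yx ys in xs].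
Qed.

Lemma prod_XsubC_double (K : comNzRingType) (s : seq K) : ~~ uniq s ->
  exists z q, \prod_(x <- s) ('X - x%:P) = ('X - z%:P) * ('X - z%:P) * q.
Proof.
elim: s => // x s IH /=; rewrite negb_and negbK big_cons.
move=> /orP[xs|/IH[z [q ->]]].
  exists x, (\prod_(y <- rem x s) ('X - y%:P)).
  by rewrite (big_rem x)//= mulrA.
by exists z, (('X - x%:P) * q); rewrite mulrCA.
Qed.

(** The top coefficient of the derivative is the degree times [lead_coef p], nonzero in
    characteristic zero. *)
Lemma poly_deriv_neq0 (K : numDomainType) (p : {poly K}) :
  (0 < (size p).-1)%N -> deriv p != 0.
Proof.
move=> n0; apply/eqP => /polyP/(_ (size p).-2); rewrite coef0 coef_deriv.
rewrite prednK// -/(lead_coef p) => /eqP.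
rewrite mulrn_eq0 lead_coef_eq0 -size_poly_eq0 eqn0Ngt n0/= => /eqP sp.
by move: n0; rewrite sp.
Qed.

Lemma poly_generic_fiber (K : numClosedFieldType) (p : {poly K}) :
  (0 < (size p).-1)%N ->
  exists E : seq K, forall w, w \notin E -> exists s : seq K,
    [/\ uniq s, size s = (size p).-1 & forall t, (t \in s) = (p.[t] == w)].
Proof.
move=> n0; have [r rE] := poly_roots_seq _ _ (poly_deriv_neq0 _ _ n0).
(* The exceptional values are the critical values: a repeated root of [p - w] is a zero of the
   derivative at which [p] equals [w]. *)
exists [seq p.[t] | t <- r] => w wE.
have sp : (1 < size p)%N by rewrite -subn1 subn_gt0 in n0.
have sq : size (p - w%:P) = size p.
  by rewrite size_polyDl// size_polyN (leq_ltn_trans (size_polyC_leq1 _)).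
have q0 : p - w%:P != 0 by rewrite -size_poly_gt0 sq ltnW.
have [s qE] := closed_field_poly_normal (p - w%:P).
have rs t : (t \in s) = (p.[t] == w).
  rewrite -root_prod_XsubC -(@rootZ _ _ (lead_coef (p - w%:P)));
    last by rewrite lead_coef_eq0.
  by rewrite -qE rootE !hornerE subr_eq0.
exists s; split=> //; last first.
  by rewrite -sq [in RHS]qE size_scale ?lead_coef_eq0// size_prod_XsubC.
apply: contraNT wE => /prod_XsubC_double[z [q sE]].
have pzw : p.[z] = w.
  by apply/eqP; rewrite -rs -root_prod_XsubC sE rootE !hornerE subrr !mul0r.
apply/mapP; exists z => //; rewrite -rE.
have -> : deriv p = deriv (p - w%:P) by rewrite derivB derivC subr0.
rewrite qE sE derivZ !derivM derivXsubC mul1r mulr1 rootE.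
have zz : ('X - z%:P).[z] = 0 by rewrite hornerXsubC subrr.
by rewrite hornerZ hornerD !hornerM hornerD zz !(mul0r, addr0) mulr0.
Qed.

(** * Geometric degree along the parametrisation *)

Section Degrees.
Variables (R : realType) (m : nat) (g : 'I_m -> {poly Cplx R}).
Local Notation C := (Cplx R).
Local Notation Gamma := (range (polymap g)).
Local Notation N := (polymap_deg g).

Lemma geometric_degree_polymap (f : 'rV[C]_m -> C) (p : {poly C}) :
  poly_generic_injection g -> (forall t, f (polymap g t) = p.[t]) ->
  (0 < (size p).-1)%N -> is_geometric_degree Gamma f (size p).-1.
Proof.
move=> [_ [Z [finZ _ injZ]]] fE n0.
have [E HE] := poly_generic_fiber _ _ n0.
exists ([set` E] `|` f @` Z).
  by rewrite finite_setU; split; [exact: finite_seq|exact: finite_image].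
move=> w wE; have /HE[s [us ss sE]] : w \notin E.
  by apply/negP => ?; apply: wE; left.
have -> : Gamma `&` f @^-1` [set w] = polymap g @` [set` s].
  apply/seteqP; split => x /=.
    by move=> [[t _ <-] ftw]; exists t => //; rewrite sE -fE ftw eqxx.
  move=> [t ts <-]; split; first by exists t.
  by rewrite fE; apply/eqP; rewrite -sE.
rewrite -ss; apply: card_eq_trans (card_uniq_seq _ _ us).
apply: inj_card_eq => t u; rewrite !inE /= => ts us'.
have notZ v : v \in s -> v \in ~` (polymap g @^-1` Z).
  move=> vs; rewrite inE /= => Zv; apply: wE; right.
  by exists (polymap g v) => //; apply/eqP; rewrite fE -sE.
by apply: injZ; exact: notZ.
Qed.

Lemma polymap_deg_gt0 : (exists s t, polymap g s <> polymap g t) -> (0 < N)%N.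
Proof.
move=> [s [t st]]; rewrite lt0n; apply/eqP => N0; apply: st.
apply/rowP => j; rewrite !mxE.
have : (size (g j) <= 1)%N.
  by have := leq_polymap_deg _ _ g j; rewrite N0 leqn0 -subn1 subn_eq0.
by move=> /size1_polyC ->; rewrite !hornerC.
Qed.

End Degrees.

(** * Algebraic sets and dimension *)

Section Dimension.
Variables (R : realType) (n : nat).
Local Notation C := (Cplx R).
Implicit Types (A : set 'rV[C]_n).

Lemma algebraicT : algebraic [set: 'rV[C]_n].
Proof.
exists 0%N, (fun=> mpoly.mpolyC n 0); apply/seteqP; split=> x //= _.
by case.
Qed.

(* The witnesses are read off the evaluation lemmas because the ring structure
   of [mpoly] is only inferred when that library is imported. *)
Lemma meval_coord_sub (i : 'I_n) (c : C) :
  exists P : mpoly.mpoly n C, forall v : 'I_n -> C, mpoly.meval v P = v i - c.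
Proof.
have [P HP] : exists P : mpoly.mpoly n C, forall v : 'I_n -> C,
    mpoly.meval v P = mpoly.meval v (mpoly.mpolyX C (mpoly.mnm1 i)) -
                      mpoly.meval v (mpoly.mpolyC n c).
  by eexists => v; apply: mpoly.mevalB.
by exists P => v; rewrite HP mpoly.mevalXU mpoly.mevalC.
Qed.

Lemma meval_coord_prod (i : 'I_n) (s : seq C) :
  exists P : mpoly.mpoly n C,
    forall v : 'I_n -> C, mpoly.meval v P = \prod_(c <- s) (v i - c).
Proof.
elim: s => [|c s [P HP]].
  by exists (mpoly.mpolyC n 1) => v; rewrite mpoly.mevalC big_nil.
have [Q HQ] := meval_coord_sub i c.
have [S HS] : exists S : mpoly.mpoly n C, forall v : 'I_n -> C,
    mpoly.meval v S = mpoly.meval v Q * mpoly.meval v P.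
  by eexists => v; apply: mpoly.mevalM.
by exists S => v; rewrite HS HQ HP big_cons.
Qed.

Lemma algebraic_coord (i : 'I_n) (s : seq C) :
  algebraic [set x : 'rV[C]_n | x 0 i \in s].
Proof.
have [P HP] := meval_coord_prod i s.
exists 1%N, (fun=> P); apply/seteqP; split=> x /=.
  move=> xs _; rewrite HP; apply/eqP; rewrite prodf_seq_eq0; apply/hasP.
  by exists (x 0 i); rewrite ?subrr ?eqxx.
move=> /(_ 0)/eqP; rewrite HP prodf_seq_eq0 => /hasP[c cs]/=.
by rewrite subr_eq0 => /eqP ->.
Qed.

Lemma algebraic_set1 (x : 'rV[C]_n) : algebraic [set x].
Proof.
have /choice[P HP] := fun i : 'I_n => meval_coord_sub i (x 0 i).
exists n, P; apply/seteqP; split=> [_ -> i|y /= yx]; first by rewrite HP subrr.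
by apply/rowP => i; apply/eqP; rewrite -subr_eq0 -HP yx.
Qed.

Lemma zariski_irreducible_set1 (x : 'rV[C]_n) : zariski_irreducible [set x].
Proof.
split; first by exists x.
by move=> B1 B2 _ _ /(_ x erefl)[]; [left|right] => _ ->.
Qed.

Lemma zariski_closed_set1 A x : A x -> zariski_closed_in A [set x].
Proof.
move=> Ax; exists [set x]; first exact: algebraic_set1.
by apply/seteqP; split => [_ ->|y []].
Qed.

(* Two distinct points of Z differ in some coordinate, and the values of that
   coordinate on the finite set Z separate them by algebraic sets. *)
Lemma finite_irreducible_subset1 (Z : set 'rV[C]_n) :
  finite_set Z -> zariski_irreducible Z -> is_subset1 Z.
Proof.
move=> finZ [_ irr] x y Zx Zy; apply/rowP => i.
apply: contrapT => /eqP xy.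
have /finite_seqP[s sE] : finite_set [set z 0 i | z in Z].
  exact: finite_image.
have [] := irr _ _ (algebraic_coord i [:: x 0 i])
                   (algebraic_coord i [seq c <- s | c != x 0 i]).
- move=> z Zz /=; have [zx|zx] := eqVneq (z 0 i) (x 0 i).
    by left; rewrite zx inE.
  right; rewrite mem_filter zx /=.
  have : [set z 0 i | z in Z] (z 0 i) by exists z.
  by rewrite sE.
- by move=> /(_ _ Zy) /=; rewrite inE eq_sym (negbTE xy).
- by move=> /(_ _ Zx) /=; rewrite mem_filter eqxx.
Qed.

(** A point is a chain of length 0. In a chain of length 1 the larger member is finite and
    irreducible, hence a single point, which has no nonempty proper subset. *)
Lemma finite_has_dim0 A : finite_set A -> A !=set0 -> has_dim A 0.
Proof.
move=> finA [x Ax]; split.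
  exists (fun=> [set x]); split => // i _; split.
    exact: zariski_closed_set1.
  exact: zariski_irreducible_set1.
move=> [Z [ZP Zlt]].
have [[B _ Z1E] irr1] := ZP 1%N isT.
have [_ [[z0 Zz0] _]] := ZP 0%N isT.
have [sub nsub] := Zlt 0%N isT.
apply: nsub => y Zy.
suff <- : z0 = y by [].
apply: (finite_irreducible_subset1 (Z 1%N)) => //; last exact: sub.
by apply: sub_finite_set finA; rewrite Z1E => u [].
Qed.

End Dimension.

(** * Hyperplane sections of the curve *)

Section ProjectiveDegree.
Variables (R : realType) (m : nat) (g : 'I_m -> {poly Cplx R}).
Local Notation C := (Cplx R).
Local Notation Gamma := (range (polymap g)).
Local Notation N := (polymap_deg g).

Lemma horner_mmap_polymap (P : mpoly.mpoly m C) (t : C) :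
  (mpoly.mmap polyC g P).[t] = mpoly.meval (fun i => polymap g t 0 i) P.
Proof.
have := @rmorph_mmap _ _ _ polyC g (horner_eval t) P.
rewrite /= /horner_eval => -> => [|c]; last by rewrite /= hornerC.
by apply: mpoly.meval_eq => i; rewrite /= mxE.
Qed.

(** Some equation of [B] pulls back to a nonzero polynomial in [t]; otherwise all of them would
    vanish on the curve. *)
Lemma polymap_not_sub_algebraic (B : set 'rV[C]_m) :
  algebraic B -> ~ (Gamma `<=` B) ->
  exists2 q : {poly C}, q != 0 & forall t, B (polymap g t) -> q.[t] = 0.
Proof.
move=> [k [ps ->]] nsub; apply: contrapT => H; apply: nsub => _ [t _ <-] j.
rewrite -horner_mmap_polymap.
have [->|q0] := eqVneq (mpoly.mmap polyC g (ps j)) 0.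
  by rewrite horner0.
exfalso; apply: H; exists (mpoly.mmap polyC g (ps j)) => // u /(_ j) <-.
by rewrite horner_mmap_polymap.
Qed.

(** If neither closed set contained the curve, the product of two nonzero polynomials would vanish
    at every [t]. *)
Lemma zariski_irreducible_polymap : zariski_irreducible Gamma.
Proof.
split; first by exists (polymap g 0); exists 0.
move=> B1 B2 aB1 aB2 sub; apply: contrapT => /not_orP[].
move=> /(polymap_not_sub_algebraic _ aB1)[q1 q10 H1].
move=> /(polymap_not_sub_algebraic _ aB2)[q2 q20 H2].
have [t] := poly_nonroot _ _ (mulf_neq0 q10 q20).
rewrite hornerM => /eqP; apply.
have [/H1 ->|/H2 ->] := sub (polymap g t) (ex_intro2 _ _ t I erefl).
  by rewrite mul0r.
by rewrite mulr0.
Qed.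

Lemma polymap_irreducible_chain1 :
  (exists s t, polymap g s <> polymap g t) -> irreducible_chain Gamma 1.
Proof.
move=> [s [t st]].
exists (fun i => if i == 0%N then [set polymap g s] else Gamma); split.
  move=> [|i] _ /=; split.
  - by apply: zariski_closed_set1; exists s.
  - exact: zariski_irreducible_set1.
  - by exists setT; rewrite ?setIT//; exact: algebraicT.
  - exact: zariski_irreducible_polymap.
move=> [|//] _ /=; split; first by move=> _ ->; exists s.
by move=> /(_ (polymap g t) (ex_intro2 _ _ t I erefl)) /= ts; apply: st.
Qed.

Lemma projective_degree_polymap :
  poly_generic_injection g -> is_projective_degree Gamma N.
Proof.
move=> gi; have nc := gi.1; have N0 := polymap_deg_gt0 _ _ g nc.
split.
  have [j jN] := polymap_deg_attained _ _ g N0.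
  (* A generic level set of a coordinate of degree [N] is a hyperplane section with exactly [N]
     points. *)
  have [E finE] : is_geometric_degree Gamma (fun x => x 0 j) N.
    rewrite -jN; apply: geometric_degree_polymap => //; last by rewrite jN.
    by move=> t; rewrite mxE.
  have [w wE] : exists w, ~ E w.
    have [s ->] := (finite_seqP E).1 finE.
    have [w] := poly_nonroot _ _ (monic_neq0 (monic_prod_XsubC s xpredT id)).
    rewrite -rootE root_prod_XsubC => ws; exists w => /=.
    exact/negP.
  move=> /(_ _ wE) cardN.
  pose H := [set x : 'rV[C]_m |
    \sum_(i < m) (delta_mx 0 j : 'rV[C]_m) 0 i * x 0 i = w].
  have HE : H `&` Gamma = Gamma `&` (fun x => x 0 j) @^-1` [set w].
    rewrite setIC; congr (_ `&` _); apply/seteqP; split => x /=;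
    rewrite /H /= (bigD1 j)//= mxE !eqxx mul1r big1 ?addr0// => i /negbTE ij;
    by rewrite mxE ij andbF mul0r.
  exists H; rewrite HE; split => //.
    exists (delta_mx 0 j), w; split => //.
    by apply/eqP => /rowP/(_ j); rewrite !mxE !eqxx => /eqP; rewrite oner_eq0.
  apply: finite_has_dim0; first by apply/finite_setP; exists N.
  apply/set0P/eqP => e; move: cardN; rewrite e card_eq_sym card_eq0.
  by move=> /eqP/seteqP[/(_ 0%N N0)].
move=> H [a [b [a0 HE]]] dimH.
pose q := \sum_i a 0 i *: g i - b%:P.
have qE t : q.[t] = \sum_i a 0 i * (polymap g t) 0 i - b.
  rewrite /q hornerD hornerN hornerC horner_sum; congr (_ - _).
  by apply: eq_bigr => i _; rewrite hornerZ mxE.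
have Hroot t : H (polymap g t) <-> root q t.
  rewrite HE /= rootE qE subr_eq0; split => [->//|/eqP//].
(* If [q = 0], the section is the whole curve, which has a chain of length 1. Otherwise the section
   is the image of the roots of [q], at most [N] in number. *)
have [q0|q0] := eqVneq q 0.
  case: dimH => _; suff -> : H `&` Gamma = Gamma.
    by move=> /(_ (polymap_irreducible_chain1 nc)).
  by apply/setIidr => _ [t _ <-]; apply/Hroot; rewrite q0 root0.
have sq : (size q <= N.+1)%N.
  rewrite (leq_trans (size_polyD _ _))// geq_max size_polyN.
  rewrite (leq_trans (size_polyC_leq1 _))// andbT.
  rewrite (leq_trans (size_sum _ _ _))//; apply/bigmax_leqP => i _.
  rewrite (leq_trans (size_scale_leq _ _))// -ltnS.
  by have := leq_polymap_deg _ _ g i; rewrite -subn1 leq_subLR add1n ltnS.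
have [s sE] := poly_roots_seq _ _ q0.
have HG : H `&` Gamma = polymap g @` [set` undup s].
  apply/seteqP; split => x /=.
    move=> [Hx [t _ tx]]; exists t => //=.
    by rewrite mem_undup -sE; apply/Hroot; rewrite tx.
  move=> [t]; rewrite /= mem_undup -sE => /Hroot Ht <-; split => //.
  by exists t.
rewrite HG; apply: card_le_trans (card_image_le _ _) _.
rewrite (card_le_eql (card_uniq_seq _ _ (undup_uniq s))) card_le_II -ltnS.
apply: leq_trans sq; apply: max_poly_roots => //; last exact: undup_uniq.
by apply/allP => t; rewrite mem_undup -sE.
Qed.

End ProjectiveDegree.

Theorem theorem5p6 (R : realType) (m : nat) (g : 'I_m -> {poly Cplx R})
    (f : 'rV[Cplx R]_m -> Cplx R) :
  let Gamma := range (polymap g) in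
  poly_generic_injection g ->
  c_holomorphic Gamma f ->
  algebraic (graph_on Gamma f) ->
  (exists x y, [/\ Gamma x, Gamma y & f x <> f y]) ->
  exists (p : {poly Cplx R}) (d e : nat),
    [/\ forall t, f (polymap g t) = p.[t],
        is_geometric_degree Gamma f d,
        is_projective_degree Gamma e &
        [/\ lojasiewicz_exponent_infty Gamma f = growth_exponent Gamma f,
            growth_exponent Gamma f = (d%:R / e%:R)%:E &
            d%:R / e%:R = (size p).-1%:R / (polymap_deg g)%:R :> R]].
Proof.
move=> Gamma gi [cf _] agraph [x [y [[s _ <-] [t _ <-] fst]]].
have [p fE] := algebraic_graph_poly _ _ _ _ cf agraph.
have n0 : (0 < (size p).-1)%N.
  rewrite lt0n; apply/eqP => n0; apply: fst; rewrite !fE.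
  have /size1_polyC -> : (size p <= 1)%N by rewrite -subn_eq0 subn1 n0.
  by rewrite !hornerC.
have N0 := polymap_deg_gt0 _ _ g gi.1.
(* Both degrees are the polynomial ones, so the last equality of quotients holds by reflexivity. *)
exists p, (size p).-1, (polymap_deg g); split => //.
- exact: geometric_degree_polymap.
- exact: projective_degree_polymap.
- have LE := lojasiewicz_exponent_inftyE _ _ _ _ _ fE N0 n0.
  have BE := growth_exponentE _ _ _ _ _ fE N0 n0.
  by rewrite LE BE.
Qed.
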